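(* Let $r$ be any prime dividing $p(q-1)$ and let $H$ be a Sylow $r$-subgroup of $G^n$. Then the fixed-point subring $R_H$ of $\mathcal A_n$ by $H$ is a free $\mathbb F_q$-algebra, isomorphic to $\mathcal A_n$.
   Context: $\mathbb F_q$ is the finite field with $q$ elements, $q$ a power of a prime $p$; $\mathcal A_n=\mathbb F_q[x_1,\ldots,x_n]$, $n\ge1$. $G\le \mathrm{GL}_2(\mathbb F_q)$ is the group of matrices $\begin{pmatrix}a&b\\0&1\end{pmatrix}$ with $a\ne0$, and $G^n$ is the direct product of $n$ copies. For $\mathbf A=(A_1,\ldots,A_n)\in G^n$, $A_i=\begin{pmatrix}a_i&b_i\\0&1\end{pmatrix}$, and $f\in\mathcal A_n$, $\mathbf A\circ f:=f(a_1x_1+b_1,\ldots,a_nx_n+b_n)$. For a subgroup $H\le G^n$, $R_H:=\{f\in\mathcal A_n:\mathbf A\circ f=f\ \text{for all }\mathbf A\in H\}$. A finitely generated $\mathbb F_q$-algebra $R\subseteq\mathcal A_n$ is free if it can be generated by a finite set of elements that are algebraically independent over $\mathbb F_q$. *)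

(* Defs.v *)
From HB Require Import structures.
From mathcomp Require Import all_boot all_fingroup all_algebra all_solvable.
From mathcomp.multinomials Require Export mpoly.

Set Implicit Arguments.
Unset Strict Implicit.
Unset Printing Implicit Defensive.

Import GRing.Theory.
Local Open Scope ring_scope.

Section AffineGroup.
Variable F : finFieldType.

(* Bottom row (0, 1); the upper left entry is then nonzero because A is
   invertible. *)
Definition aff_set : {set {'GL_2[F]}} :=
  [set A : {'GL_2[F]} | (GLval A 1 0 == 0) && (GLval A 1 1 == 1)].

Lemma aff_set_group : group_set aff_set.
Proof.
apply/group_setP; split=> [|A B]; first by rewrite inE GL_1E !mxE !eqxx.
rewrite !inE => /andP[/eqP A10 /eqP A11] /andP[/eqP B10 /eqP B11].
rewrite GL_MxE !mxE !big_ord_recl !big_ord0 !addr0.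
have -> : lift ord0 ord0 = 1 :> 'I_2 by apply/val_inj.
by rewrite A10 A11 B10 B11 !mul0r mulr0 mulr1 !add0r !eqxx.
Qed.

Definition aff_group : {group {'GL_2[F]}} := Group aff_set_group.

Definition GLpow (n : nat) : finGroupType :=
  {dffun forall i : 'I_n, {'GL_2[F]}}.

Definition aff_pow (n : nat) : {group GLpow n} :=
  setXn_group (fun _ : 'I_n => aff_group).

End AffineGroup.

Section FixedSubring.
Variables (F : finFieldType) (n : nat).

Definition aff_act (A : GLpow F n) (f : {mpoly F[n]}) : {mpoly F[n]} :=
  f \mPo [tuple GLval (A i) 0 0 *: 'X_i + (GLval (A i) 0 1)%:MP | i < n].

Definition fixed_pred (H : {set GLpow F n}) : {pred {mpoly F[n]}} :=
  fun f => [forall A in H, aff_act A f == f].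

Lemma fixed_predP (H : {set GLpow F n}) (f : {mpoly F[n]}) :
  reflect (forall A, A \in H -> aff_act A f = f) (f \in fixed_pred H).
Proof. exact: 'forall_in_eqP. Qed.

Lemma fixed_subalg_closed (H : {set GLpow F n}) :
  subalg_closed (fixed_pred H).
Proof.
split=> [|c f g /fixed_predP Hf /fixed_predP Hg|f g /fixed_predP Hf
  /fixed_predP Hg]; apply/fixed_predP=> A HA; rewrite /aff_act.
- exact: comp_mpoly1.
- by rewrite linearP; congr (_ *: _ + _); [exact: Hf | exact: Hg].
- by rewrite rmorphM; congr (_ * _); [exact: Hf | exact: Hg].
Qed.

HB.instance Definition _ (H : {set GLpow F n}) :=
  GRing.isSubalgClosed.Build F {mpoly F[n]} (fixed_pred H)
    (fixed_subalg_closed H).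

Record fixed_subring (H : {set GLpow F n}) := FixedSubring {
  fixed_val :> {mpoly F[n]};
  _ : fixed_val \in fixed_pred H }.

HB.instance Definition _ (H : {set GLpow F n}) := [isSub for @fixed_val H].
HB.instance Definition _ (H : {set GLpow F n}) :=
  [Choice of fixed_subring H by <:].
HB.instance Definition _ (H : {set GLpow F n}) :=
  [SubChoice_isSubAlgebra of fixed_subring H by <:].
HB.instance Definition _ (H : {set GLpow F n}) :=
  [SubNzRing_isSubComNzRing of fixed_subring H by <:].

End FixedSubring.

Definition alg_independent (F : fieldType) (n k : nat)
    (t : k.-tuple {mpoly F[n]}) : Prop :=
  forall P : {mpoly F[k]}, P \mPo t = 0 -> P = 0.

Definition alg_generated (F : fieldType) (n k : nat)
    (t : k.-tuple {mpoly F[n]}) (R : {pred {mpoly F[n]}}) : Prop :=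
  forall f : {mpoly F[n]}, f \in R <-> exists P : {mpoly F[k]}, f = P \mPo t.

Definition free_subalgebra (F : fieldType) (n : nat)
    (R : {pred {mpoly F[n]}}) : Prop :=
  exists (k : nat) (t : k.-tuple {mpoly F[n]}),
    alg_independent t /\ alg_generated t R.

(* Main.v *)
(* A Sylow subgroup H of G^n is a product of subgroups K_i of G, being maximal
   among r-groups. The invariants of K_i in one variable x, over any integral
   domain of coefficients, are the polynomials in N_i(x), the product of the
   affine polynomials in K_i. Treating the variables one at a time, with the
   other variables as coefficients, gives R_H = F[N_1(x_1), ..., N_n(x_n)]. *)
From HB Require Import structures.
Require Import Defs.
From mathcomp Require Import all_boot all_fingroup all_algebra all_solvable.

Set Implicit Arguments.
Unset Strict Implicit.
Unset Printing Implicit Defensive.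

Import GRing.Theory.
Local Open Scope ring_scope.

(** * Affine polynomials and the orbit polynomial of a subgroup of G *)

Section AffinePolynomials.
Variable F : finFieldType.
Implicit Types A B : {'GL_2[F]}.

Definition aff_poly A : {poly F} := GLval A 0 0 *: 'X + (GLval A 0 1)%:P.

Lemma aff_groupE A : A \in aff_group F ->
  [/\ GLval A 1 0 = 0, GLval A 1 1 = 1 & GLval A 0 0 != 0].
Proof.
rewrite inE => /andP[/eqP A10 /eqP A11]; split=> //.
(* Expanding along the bottom row (0, 1) leaves the upper left entry as the determinant. *)
have := GL_det A; rewrite (expand_det_row _ 1) !big_ord_recl big_ord0.
have -> : lift ord0 ord0 = 1 :> 'I_2 by apply/val_inj.
rewrite A10 A11 mul0r add0r addr0 mul1r /cofactor addnn -mul2n exprM sqrrN.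
rewrite expr1n mul1r det_mx11 !mxE.
suff -> : lift 1 0 = 0 :> 'I_2 by [].
exact/val_inj.
Qed.

Lemma size_aff_poly A : A \in aff_group F -> size (aff_poly A) = 2.
Proof.
case/aff_groupE=> _ _ A00; rewrite size_polyDl size_scale ?size_polyX //.
by rewrite (leq_ltn_trans (size_polyC_leq1 _)).
Qed.

Lemma aff_polyM A B : B \in aff_group F ->
  aff_poly (A * B)%g = aff_poly A \Po aff_poly B.
Proof.
case/aff_groupE=> B10 B11 _.
rewrite /aff_poly GL_MxE !mxE !big_ord_recl !big_ord0 !addr0.
have -> : lift ord0 ord0 = 1 :> 'I_2 by apply/val_inj.
rewrite B10 B11 mulr0 addr0 mulr1 comp_polyD comp_polyZ comp_polyX comp_polyC.
by rewrite scalerDr scalerA polyCD -addrA -[X in _ + (X + _)]mul_polyC -polyCM.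
Qed.

Lemma aff_poly_inj : {in aff_group F &, injective aff_poly}.
Proof.
move=> A B /aff_groupE[A10 A11 _] /aff_groupE[B10 B11 _] eqAB.
apply/val_inj/matrixP=> i j.
have e1 : GLval A 0 1 = GLval B 0 1.
  have /(congr1 (fun p : {poly F} => p`_0)) := eqAB.
  by rewrite !coefD !coefZ !coefX !coefC !mulr0 !add0r.
have e0 : GLval A 0 0 = GLval B 0 0.
  have /(congr1 (fun p : {poly F} => p`_1)) := eqAB.
  by rewrite !coefD !coefZ !coefX !coefC !mulr1 !addr0.
have ord2 (k : 'I_2) : k = 0 \/ k = 1.
  by case: k => [[|[|k]]] // lt_k2; [left | right]; apply/val_inj.
by case: (ord2 i) => ->; case: (ord2 j) => ->; rewrite // ?A10 ?A11 ?B10 ?B11.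
Qed.

Definition orbit_poly (K : {set {'GL_2[F]}}) := \prod_(A in K) aff_poly A.

Variable K : {group {'GL_2[F]}}.
Hypothesis sKG : K \subset aff_group F.

Lemma size_orbit_poly : size (orbit_poly K) = #|K|.+1.
Proof.
rewrite size_prod => [|A /(subsetP sKG) GA]; last first.
  by rewrite -size_poly_gt0 size_aff_poly.
rewrite (eq_bigr (fun=> 2)) => [|A /(subsetP sKG)/size_aff_poly //].
by rewrite sum_nat_const muln2 -addnn -addSn addnK.
Qed.

(** Composition with [aff_poly A] turns the factor of B into that of BA, and right translation by A
    permutes K. *)
Lemma orbit_poly_fixed A :
  A \in K -> orbit_poly K \Po aff_poly A = orbit_poly K.
Proof.
move=> KA; rewrite /orbit_poly rmorph_prod /=.
rewrite [RHS](reindex_inj (mulIg A)) /=; apply: eq_big => [B|B KB].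
  by rewrite groupMr.
by rewrite aff_polyM ?(subsetP sKG).
Qed.

(** * Invariants in one variable over an integral domain *)

Variables (R : idomainType) (iota : {rmorphism F -> R}).
Local Notation "p ^iota" := (map_poly iota p) (at level 2, format "p ^iota").

(* Over the integral domain R[X], the polynomial f(Y) - f(X) has the distinct
   roots Y = aX + b. *)
Lemma fixed_small_size (f : {poly R}) :
    (forall A, A \in K -> f \Po (aff_poly A)^iota = f) ->
  (size f <= #|K|)%N -> (size f <= 1)%N.
Proof.
move=> fixf lefK; pose g : {poly {poly R}} := map_poly polyC f - f%:P.
have root_g A : A \in K -> root g (aff_poly A)^iota.
  by move=> /fixf fA; rewrite /root !hornerE -/(comp_poly _ _) fA subrr.
have g0 : g = 0.
  apply/eqP; apply/negPn/negP=> g_neq0.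
  have rs_uniq : uniq [seq (aff_poly A)^iota | A <- enum K].
    rewrite map_inj_in_uniq ?enum_uniq // => A B; rewrite !mem_enum => KA KB.
    by move/map_poly_inj/aff_poly_inj; apply; apply: (subsetP sKG).
  have rs_root : all (root g) [seq (aff_poly A)^iota | A <- enum K].
    by apply/allP=> _ /mapP[A /[!mem_enum] KA ->]; apply: root_g.
  have := max_poly_roots g_neq0 rs_root rs_uniq.
  rewrite size_map -cardE ltnNge (leq_trans (size_polyD _ _)) // geq_max.
  rewrite size_polyN size_map_polyC lefK.
  by rewrite (leq_trans (size_polyC_leq1 _)) ?cardG_gt0.
(* The constant coefficient in Y of g is f_0 - f(X), so f equals the constant f_0. *)
have := congr1 (fun p : {poly {poly R}} => p`_0) g0.
rewrite coefB coefC coef_map coef0 /= => /eqP; rewrite subr_eq0 => /eqP <-.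
exact: size_polyC_leq1.
Qed.

(* Divide by the orbit polynomial N: by uniqueness quotient and remainder are
   again fixed, and the remainder is constant. *)
Lemma fixed_comp_orbit_poly (f : {poly R}) :
    (forall A, A \in K -> f \Po (aff_poly A)^iota = f) ->
  exists g, f = g \Po (orbit_poly K)^iota.
Proof.
set N := (orbit_poly K)^iota.
have sizeN : size N = #|K|.+1 by rewrite size_map_poly size_orbit_poly.
(* Division by N works over the domain [R] because its leading coefficient comes from a nonzero
   element of the field F. *)
have unitN : lead_coef N \in GRing.unit.
  rewrite lead_coef_map rmorph_unit // unitfE lead_coef_eq0.
  by rewrite -size_poly_eq0 size_orbit_poly.
have [m] := ubnP (size f); elim: m f => // m IHm f lt_fm fixf.
have [->|f_neq0] := eqVneq f 0; first by exists 0; rewrite comp_poly0.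
have N_neq0 : N != 0 by rewrite -size_poly_eq0 sizeN.
have defN A : A \in K -> N \Po (aff_poly A)^iota = N.
  by move=> KA; rewrite -map_comp_poly orbit_poly_fixed.
have fixqr A : A \in K -> (f %/ N) \Po (aff_poly A)^iota = f %/ N
    /\ (f %% N) \Po (aff_poly A)^iota = f %% N.
  move=> KA; have size2 : size (aff_poly A)^iota = 2.
    by rewrite size_map_poly size_aff_poly ?(subsetP sKG).
  have eq_f : f = ((f %/ N) \Po (aff_poly A)^iota) * N
                  + ((f %% N) \Po (aff_poly A)^iota).
    rewrite -{1}(fixf A KA) {1}(Pdiv.IdomainUnit.divp_eq unitN f).
    by rewrite comp_polyD comp_polyM defN.
  have lt_rN : (size ((f %% N)%R \Po (aff_poly A)^iota) < size N)%N.
    by rewrite size_comp_poly2 // ltn_modp.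
  split.
    exact: (Pdiv.IdomainUnit.divpP unitN eq_f lt_rN).
  exact: (Pdiv.IdomainUnit.modpP unitN eq_f lt_rN).
have [g def_g] : exists g, f %/ N = g \Po N.
  apply: IHm => [|A /fixqr[]]; last by [].
  rewrite size_divp // sizeN /= -ltnS (leq_trans _ lt_fm) // !ltnS ltn_subrL.
  by rewrite cardG_gt0 size_poly_gt0.
(* N has size |K| + 1, so the remainder has size at most |K|, the bound that [fixed_small_size] asks
   for. *)
have /size1_polyC def_r : (size (f %% N)%R <= 1)%N.
  apply: fixed_small_size => [A /fixqr[] _|]; first by [].
  by rewrite -ltnS -sizeN ltn_modp.
exists (g * 'X + ((f %% N)`_0)%:P).
by rewrite comp_poly_MXaddC -def_g -def_r -Pdiv.IdomainUnit.divp_eq.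
Qed.

End AffinePolynomials.

(** * Substitutions acting on each variable separately *)

Section DiagonalSubstitution.
Variables (F : finFieldType) (n : nat).
Implicit Types (f g : {mpoly F[n]}) (v w : 'I_n -> {poly F}) (i j : 'I_n).

Lemma mpoly_rmorph_eq (S : nzRingType)
    (phi psi : {rmorphism {mpoly F[n]} -> S}) :
    (forall c, phi c%:MP = psi c%:MP) -> (forall i, phi 'X_i = psi 'X_i) ->
  phi =1 psi.
Proof.
move=> eqC eqX f; rewrite (mpolyE f) !rmorph_sum; apply: eq_bigr => m _ /=.
rewrite -mul_mpolyC !rmorphM eqC mpolyXE_id !rmorph_prod; congr (_ * _).
by apply: eq_bigr => i _; rewrite !rmorphXn eqX.
Qed.

Local Notation "p ^iota" := (map_poly (@mpolyC n F) p)
  (at level 2, format "p ^iota").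

Definition eval_var i (p : {poly F}) : {mpoly F[n]} := p^iota.['X_i].

(** Each variable goes to a polynomial in itself alone, so these maps compose coordinatewise. Both
    the action of G^n and the parametrization of the invariants have this form. *)
Definition diag_subst v : {mpoly F[n]} -> {mpoly F[n]} :=
  comp_mpoly [tuple eval_var i (v i) | i < n].

HB.instance Definition _ v := GRing.RMorphism.on (diag_subst v).
HB.instance Definition _ v := GRing.Linear.on (diag_subst v).

Lemma eval_varX i : eval_var i 'X = 'X_i.
Proof. by rewrite /eval_var map_polyX hornerX. Qed.

Lemma diag_substC v c : diag_subst v c%:MP = c%:MP.
Proof. exact: comp_mpolyC. Qed.

Lemma diag_substX v i : diag_subst v 'X_i = eval_var i (v i).
Proof. by rewrite /diag_subst comp_mpolyXU -tnth_nth tnth_mktuple. Qed.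

Lemma eq_diag_subst v w : v =1 w -> diag_subst v =1 diag_subst w.
Proof.
move=> eq_vw; apply: mpoly_rmorph_eq => [c|i] /=; first by rewrite !diag_substC.
by rewrite !diag_substX eq_vw.
Qed.

Lemma diag_subst_eval_var v i p :
  diag_subst v (eval_var i p) = eval_var i (p \Po v i).
Proof.
rewrite /eval_var -horner_map /= diag_substX map_comp_poly horner_comp.
rewrite -map_poly_comp; congr (_.[_]).
by apply: eq_map_poly => c /=; rewrite diag_substC.
Qed.

Lemma diag_subst_comp v w f :
  diag_subst w (diag_subst v f) = diag_subst (fun i => v i \Po w i) f.
Proof.
move: f; apply: (mpoly_rmorph_eq (phi := diag_subst w \o diag_subst v))
  => [c|i] /=; first by rewrite !diag_substC.
by rewrite !diag_substX diag_subst_eval_var.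
Qed.

Lemma diag_subst_id f : diag_subst (fun=> 'X) f = f.
Proof.
move: f; apply: (mpoly_rmorph_eq (psi := idfun)) => [c|i] /=.
  by rewrite diag_substC.
by rewrite diag_substX eval_varX.
Qed.

Lemma aff_actE (A : GLpow F n) f :
  aff_act A f = diag_subst (fun i => aff_poly (A i)) f.
Proof.
rewrite /aff_act /diag_subst; congr (_ \mPo _); apply: eq_from_tnth => i.
rewrite !tnth_mktuple /eval_var /aff_poly rmorphD /= map_polyZ map_polyX.
by rewrite map_polyC !hornerE mul_mpolyC.
Qed.

Definition single i p : 'I_n -> {poly F} := fun j => if j == i then p else 'X.

(* The ring F[x_1, ..., x_n] embedded in F[x_1, ..., x_n][X] by x_i |-> X; the
   coefficients of the image do not involve x_i. *)
Definition isolate i : {mpoly F[n]} -> {poly {mpoly F[n]}} :=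
  mmap (polyC \o @mpolyC n F) (fun j => if j == i then 'X else ('X_j)%:P).

HB.instance Definition _ i := GRing.RMorphism.on (isolate i).

Lemma isolateC i c : isolate i c%:MP = (c%:MP)%:P.
Proof. exact: mmapC. Qed.

Lemma isolateX i j : isolate i 'X_j = if j == i then 'X else ('X_j)%:P.
Proof. by rewrite /isolate mmapX mmap1U. Qed.

Lemma isolateK i f : (isolate i f).['X_i] = f.
Proof.
move: f; apply: (mpoly_rmorph_eq (phi := horner_eval 'X_i \o isolate i)
  (psi := idfun)) => [c|j] /=; rewrite /horner_eval.
  by rewrite isolateC hornerC.
by rewrite isolateX; case: eqP => [->|_]; rewrite ?hornerX ?hornerC.
Qed.

(** This turns substitution in x_i into composition in one variable, where the results over an
    integral domain apply. *)
Lemma isolate_single i p f :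
  isolate i (diag_subst (single i p) f) = isolate i f \Po p^iota.
Proof.
move: f; apply: (mpoly_rmorph_eq (phi := isolate i \o diag_subst (single i p))
  (psi := comp_poly p^iota \o isolate i)) => [c|j] /=.
  by rewrite diag_substC isolateC comp_polyC.
rewrite diag_substX isolateX /single; case: eqP => [->|/eqP/negPf ji].
  rewrite comp_polyX /eval_var -horner_map /= isolateX eqxx.
  rewrite -[RHS]comp_polyXr /comp_poly -!map_poly_comp; congr (_.[_]).
  by apply: eq_map_poly => c /=; rewrite isolateC.
by rewrite eval_varX isolateX ji comp_polyC.
Qed.

(** Setting x_i to 0 serves as a projection onto the polynomials free of x_i. *)
Definition zero_var i : {mpoly F[n]} -> {mpoly F[n]} :=
  comp_mpoly [tuple if j == i then 0 else 'X_j | j < n].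

HB.instance Definition _ i := GRing.RMorphism.on (zero_var i).

Lemma zero_varC i c : zero_var i c%:MP = c%:MP.
Proof. exact: comp_mpolyC. Qed.

Lemma zero_varX i j : zero_var i 'X_j = if j == i then 0 else 'X_j.
Proof. by rewrite /zero_var comp_mpolyXU -tnth_nth tnth_mktuple. Qed.

Lemma zero_var_isolate i f : map_poly (zero_var i) (isolate i f) = isolate i f.
Proof.
move: f; apply: (mpoly_rmorph_eq (phi := map_poly (zero_var i) \o isolate i))
  => [c|j] /=; first by rewrite isolateC map_polyC /= zero_varC.
rewrite isolateX; case: eqP => [_|/eqP/negPf ji]; first by rewrite map_polyX.
by rewrite map_polyC /= zero_varX ji.
Qed.

Lemma diag_subst_zero_var i p f :
  diag_subst (single i p) (zero_var i f) = zero_var i f.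
Proof.
move: f; apply: (mpoly_rmorph_eq (phi := diag_subst (single i p) \o zero_var i))
  => [c|j] /=; first by rewrite zero_varC diag_substC.
rewrite zero_varX; case: eqP => [_|/eqP/negPf ji]; first exact: rmorph0.
by rewrite diag_substX /single ji eval_varX.
Qed.

(** After isolation of x_i, this is the injectivity of composition with a nonconstant polynomial
    over a domain. *)
Lemma single_subst_eq0 i (p : {poly F}) f : (1 < size p)%N ->
  diag_subst (single i p) f = 0 -> f = 0.
Proof.
move=> p_gt1 /(congr1 (isolate i)); rewrite isolate_single rmorph0 => /eqP.
rewrite comp_poly_eq0; last first.
  by rewrite size_map_poly_id0 // mpolyC_eq0 lead_coef_eq0 -size_poly_gt0 ltnW.
by move=> /eqP f0; rewrite -[f](isolateK i) f0 horner0.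
Qed.

Lemma single_fixed i (K : {group {'GL_2[F]}}) f : K \subset aff_group F ->
    (forall A, A \in K -> diag_subst (single i (aff_poly A)) f = f) ->
  exists g, f = diag_subst (single i (orbit_poly K)) g.
Proof.
move=> sKG fixf; set N := orbit_poly K.
have [g def_g] : exists g : {poly {mpoly F[n]}}, isolate i f = g \Po N^iota.
  apply: fixed_comp_orbit_poly => // A KA.
  by rewrite -isolate_single fixf.
(* The coefficients of [g] may involve x_i. Those of [isolate i f] and of N do not, so setting x_i
   to 0 in the coefficients of [g] preserves the equation. *)
have {}def_g : isolate i f = map_poly (zero_var i) g \Po N^iota.
  rewrite -zero_var_isolate def_g map_comp_poly -(map_poly_comp _ _ N).
  by congr (_ \Po _); apply: eq_map_poly => c /=; rewrite zero_varC.
(* As the coefficients are now free of x_i, substituting N(x_i) for x_i in this witness affects only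
   the place of X. *)
exists (map_poly (zero_var i) g).['X_i].
rewrite -[LHS](isolateK i) def_g horner_comp -horner_map /= diag_substX.
rewrite /single eqxx -(map_poly_comp _ _ g); congr (_.[_]).
by apply: eq_map_poly => c /=; rewrite diag_subst_zero_var.
Qed.

(** * Induction over the variables *)

Definition restrict_to (s : seq 'I_n) v : 'I_n -> {poly F} :=
  fun j => if j \in s then v j else 'X.

Lemma restrict_to_cons i s v f : i \notin s ->
  diag_subst (restrict_to (i :: s) v) f
    = diag_subst (restrict_to s v) (diag_subst (single i (v i)) f).
Proof.
move=> /negPf i_s; rewrite diag_subst_comp; apply: eq_diag_subst => j.
rewrite /restrict_to /single inE; case: eqP => [->|_] /=.
  by rewrite i_s comp_polyXr.
by rewrite comp_polyX.
Qed.

Lemma restrict_to_comm i s v p f : i \notin s ->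
  diag_subst (restrict_to s v) (diag_subst (single i p) f)
    = diag_subst (single i p) (diag_subst (restrict_to s v) f).
Proof.
move=> /negPf i_s; rewrite !diag_subst_comp; apply: eq_diag_subst => j.
rewrite /restrict_to /single; case: (eqVneq j i) => [->|_].
  by rewrite i_s comp_polyX comp_polyXr.
by rewrite comp_polyX comp_polyXr.
Qed.

Lemma restrict_to_subst_eq0 s v f : uniq s -> (forall i, 1 < size (v i))%N ->
  diag_subst (restrict_to s v) f = 0 -> f = 0.
Proof.
move=> + v_gt1; elim: s f => [|i s IHs] f /=; first by rewrite diag_subst_id.
move=> /andP[i_s /IHs{}IHs]; rewrite restrict_to_cons // => /IHs.
exact: single_subst_eq0.
Qed.

Lemma restrict_to_enum v : restrict_to (enum 'I_n) v =1 v.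
Proof. by move=> i; rewrite /restrict_to mem_enum. Qed.

(** Applied to the orbit polynomials, this is the algebraic independence of the N_i(x_i). *)
Lemma diag_subst_eq0 v f : (forall i, 1 < size (v i))%N ->
  diag_subst v f = 0 -> f = 0.
Proof.
move=> v_gt1; rewrite -(eq_diag_subst (restrict_to_enum v)).
exact: restrict_to_subst_eq0 (enum_uniq _) v_gt1.
Qed.

Variable K : 'I_n -> {group {'GL_2[F]}}.
Hypothesis sKG : forall i, K i \subset aff_group F.
Let N i := orbit_poly (K i).

Lemma size_orbit_poly_gt1 i : (1 < size (N i))%N.
Proof. by rewrite size_orbit_poly ?ltnS ?cardG_gt0. Qed.

Lemma restrict_to_fixed s f : uniq s ->
    {in s, forall i A, A \in K i -> diag_subst (single i (aff_poly A)) f = f} ->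
  exists g, f = diag_subst (restrict_to s N) g.
Proof.
elim: s => [|i s IHs] /=; first by exists f; rewrite diag_subst_id.
case/andP=> i_s s_uniq fixf.
have [|g def_f] := IHs s_uniq.
  by move=> j s_j A; apply: fixf; rewrite inE s_j orbT.
(* The preimage [g] is itself fixed by [K i]: substitution in x_i commutes with the injective
   substitution in the variables of [s], and f is fixed. *)
have [A KA|h def_g] := @single_fixed i (K i) g (sKG i).
  apply/eqP; rewrite -subr_eq0; apply/eqP.
  apply: (restrict_to_subst_eq0 s_uniq size_orbit_poly_gt1).
  by rewrite raddfB /= restrict_to_comm // -def_f fixf ?subrr ?mem_head.
by exists h; rewrite restrict_to_cons // -def_g.
Qed.

Lemma fixed_predE (H : {set GLpow F n}) f :
    (forall A : GLpow F n, (A \in H) = [forall i, A i \in K i]) ->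
  f \in fixed_pred H <-> exists g, f = diag_subst N g.
Proof.
move=> inH; split=> [/fixed_predP fixf | [g ->]]; last first.
  apply/fixed_predP=> A /[!inH] /forallP KA; rewrite aff_actE diag_subst_comp.
  by apply: eq_diag_subst => i; rewrite orbit_poly_fixed.
have [|g ->] := @restrict_to_fixed (enum 'I_n) f (enum_uniq _).
  (* [B] is A in coordinate i and the identity elsewhere; it lies in H because H is a full
     product. *)
  move=> i _ A KA; pose B : GLpow F n := @dfung1 _ (fun=> {'GL_2[F]}) i A.
  have /fixf : B \in H.
    by rewrite inH; apply/forallP=> j; rewrite ffunE; case: dfwithP.
  rewrite aff_actE => {2}<-; apply: eq_diag_subst => j; rewrite /single.
  case: eqP => [->|/eqP ji]; first by rewrite dfung1_id.
  rewrite dfung1_dflt 1?eq_sym // /aff_poly GL_1E !mxE scale1r.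
  by rewrite addr0.
by exists g; apply: eq_diag_subst; apply: restrict_to_enum.
Qed.

End DiagonalSubstitution.

(* The product of the coordinate projections of H is an r-group containing H,
   hence equals H by maximality. *)
Lemma Sylow_aff_powP (F : finFieldType) (n r : nat) (H : {group GLpow F n}) :
    (r.-Sylow(aff_pow F n) H)%g ->
  exists K : 'I_n -> {group {'GL_2[F]}}, (forall i, K i \subset aff_group F) /\
    forall A : GLpow F n, (A \in H) = [forall i, A i \in K i].
Proof.
move=> sylH; pose K i := (dffun_morphism (fun=> {'GL_2[F]}) i @* H)%G.
have [P inP cardP] : exists2 P : {group GLpow F n},
    forall A : GLpow F n, (A \in P) = [forall i, A i \in K i]
    & #|P| = (\prod_i #|K i|)%N.
  exists (setXn_group K); [exact: in_setXn | exact: cardsXn].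
have sKG i : K i \subset aff_group F.
  apply/subsetP=> _ /morphimP[A _ HA ->].
  by have /setXnP/(_ i) := subsetP (pHall_sub sylH) A HA.
exists K; split=> // A; suff -> : H :=: P by [].
apply/esym/(sub_pHall sylH).
- rewrite /pgroup cardP; apply: (big_ind (fun m => r.-nat m)) => // [m1 m2|i _].
    by move=> r_m1 r_m2; rewrite pnatM r_m1.
  exact: morphim_pgroup (pHall_pgroup sylH).
- apply/subsetP=> B HB; rewrite inP; apply/forallP=> i.
  by apply: mem_morphim; rewrite ?inE.
apply/subsetP=> B /[!inP] /forallP KB; apply/setXnP=> i.
exact: (subsetP (sKG i)).
Qed.

(** The isomorphism is P |-> P(t): generation makes it well defined and onto, independence makes it
    injective. *)
Lemma fixed_subring_iso (F : finFieldType) (n : nat) (H : {set GLpow F n})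
    (t : n.-tuple {mpoly F[n]}) :
    alg_independent t -> alg_generated t (fixed_pred H) ->
  exists phi : {lrmorphism {mpoly F[n]} -> fixed_subring H}, bijective phi.
Proof.
move=> t_free t_gen.
have fix_t P : P \mPo t \in fixed_pred H by apply/t_gen; exists P.
pose phi P := FixedSubring (fix_t P).
have phi_lin : linear phi by move=> c P Q; apply/val_inj; rewrite /= linearP.
have phi_mul : monoid_morphism phi.
  by split=> [|P Q]; apply/val_inj; rewrite /= ?rmorph1 ?rmorphM.
pose phiL := GRing.isLinear.Build F _ _ _ phi phi_lin.
pose phiM := GRing.isMonoidMorphism.Build _ _ phi phi_mul.
pose Phi : {lrmorphism {mpoly F[n]} -> fixed_subring H} :=
  HB.pack phi phiL phiM.
exists Phi.
(* Boolean equality lets [xchoose] select a preimage, which independence makes unique. *)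
have inv_phi (x : fixed_subring H) : exists P, P \mPo t == val x.
  by have /t_gen[P ->] := valP x; exists P.
exists (fun x => xchoose (inv_phi x)) => [P|x]; last first.
  by apply/val_inj/eqP/(xchooseP (inv_phi x)).
apply/eqP; rewrite -subr_eq0; apply/eqP/t_free.
by rewrite raddfB /= (eqP (xchooseP (inv_phi (phi P)))) subrr.
Qed.

Theorem theorem5p4 (F : finFieldType) (p n r : nat)
    (hp : p \in [pchar F]) (hn : (0 < n)%N)
    (hr : prime r) (hrd : (r %| p * (#|F| - 1))%N)
    (H : {group GLpow F n}) (hH : (r.-Sylow(aff_pow F n) H)%g) :
  free_subalgebra (fixed_pred H) /\
  exists phi : {lrmorphism {mpoly F[n]} -> fixed_subring H}, bijective phi.
Proof.
have [K [sKG inH]] := Sylow_aff_powP hH.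
(* Composition with this [t] is [diag_subst] of the orbit polynomials by conversion, so the results
   on substitutions apply directly. *)
pose t := [tuple eval_var i (orbit_poly (K i)) | i < n].
have t_free : alg_independent t.
  by move=> P; apply: diag_subst_eq0 => i; apply: size_orbit_poly_gt1.
have t_gen : alg_generated t (fixed_pred H).
  by move=> f; apply: fixed_predE.
by split; [exists n, t | apply: fixed_subring_iso t_free t_gen].
Qed.
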